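(* Let $S\in\mathcal{S}$. Then the function $$t\mapsto\frac{1}{\mathcal{C}(S(t))},\qquad t\in[\xi_\ell,\xi_r],$$ is a convex quadratic polynomial in $t$.
   Context: For a convex body $K\subset\mathbb{R}^2$ (compact convex set with nonempty interior), $|K|$ is its area, $\mathrm{Cov}(K)$ is the $2\times2$ matrix $\mathrm{Cov}(K)_{ij}=\int_K u_iu_j\frac{du}{|K|}-\int_K u_i\frac{du}{|K|}\int_K u_j\frac{du}{|K|}$, and $\mathcal{C}(K)=|K|^2/\det\mathrm{Cov}(K)$. The class $\mathcal{S}$: it consists of the symmetric convex polygons $S=\mathrm{co}\{\pm(x_1,y_1),\dots,\pm(x_m,y_m)\}\subset\mathbb{R}^2$ ($\mathrm{co}$ = convex hull), $m\ge3$, together with the labelling, such that $(x_1,y_1),\dots,(x_m,y_m),-(x_1,y_1),\dots,-(x_m,y_m)$ are the ($2m$ distinct) extreme points of $S$ listed counter-clockwise, $x_3\le x_2\le x_1$ and $0\le y_1=y_3<y_2$. Symmetric Mahler sliding: $S(t)=\mathrm{co}\{\pm(x_1,y_1),\pm(t,y_2),\pm(x_3,y_3),\dots,\pm(x_m,y_m)\}$ is obtained by replacing $x_2$ by $t$, all else fixed (so $S=S(x_2)$). The numbers $\xi_\ell<\xi_r$ are defined by: $(x_3,y_3)$ lies on the segment from $(\xi_\ell,y_2)$ to the vertex following $(x_3,y_3)$ counter-clockwise (that is $(x_4,y_4)$, or $-(x_1,y_1)$ if $m=3$), and $(x_1,y_1)$ lies on the segment from $(\xi_r,y_2)$ to the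 vertex preceding $(x_1,y_1)$, namely $-(x_m,y_m)$. *)

(* Defs.v *)
From HB Require Import structures.
From mathcomp Require Import all_boot all_order all_algebra.
From mathcomp Require Import all_classical all_reals all_analysis.

Set Implicit Arguments.
Unset Strict Implicit.
Unset Printing Implicit Defensive.

Import Order.TTheory GRing.Theory Num.Theory.
Import numFieldNormedType.Exports.

Local Open Scope classical_set_scope.
Local Open Scope ring_scope.
Local Open Scope convex_scope.

(* The plane is [R * R]; its Lebesgue measure is the product measure. *)
Notation mu2 R := (@lebesgue_measure R \x @lebesgue_measure R)%E.

Definition area (R : realType) (K : set (R * R)) : R := fine (mu2 R K).

Definition mean (R : realType) (K : set (R * R)) (f : R * R -> R) : R :=
  (\int[mu2 R]_(u in K) f u) / area K.

Definition coordinate (R : realType) (i : 'I_2) (u : R * R) : R :=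
  if i == ord0 then u.1 else u.2.

Definition Cov (R : realType) (K : set (R * R)) : 'M[R]_2 :=
  \matrix_(i, j)
    (mean K (fun u => coordinate i u * coordinate j u)
     - mean K (coordinate i) * mean K (coordinate j)).

Definition calC (R : realType) (K : set (R * R)) : R :=
  area K ^+ 2 / \det (Cov K).

Definition co (R : realType) (A : set (R * R)) : set (R * R) :=
  smallest (fun B : set (R * R) => convex_set B) A.

Definition segment (R : realType) (a b : R * R) : set (R * R) :=
  [set z | exists k : {i01 R},
     z = (a : convex_lmodType (R * R)%type) <| k |> b].

Definition extreme_points (R : realType) (K : set (R * R)) : set (R * R) :=
  [set z | K z /\
     forall (a b : R * R) (k : {i01 R}), K a -> K b ->
       0 < k%:num -> k%:num < 1 ->
       z = (a : convex_lmodType (R * R)%type) <| k |> b -> a = z /\ b = z].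

(* Twice the signed area of the triangle [a b c]: positive iff it is
   counter-clockwise. *)
Definition orientation (R : realType) (a b c : R * R) : R :=
  (b.1 - a.1) * (c.2 - a.2) - (b.2 - a.2) * (c.1 - a.1).

(* [v] runs counter-clockwise around the polygon with vertex list [v],
   starting anywhere. *)
Definition counter_clockwise (R : realType) (v : seq (R * R)) : Prop :=
  forall i j k : nat, (i < j)%N -> (j < k)%N -> (k < size v)%N ->
    0 < orientation (nth 0 v i) (nth 0 v j) (nth 0 v k).

(* The points are (x 1, y 1), ..., (x m, y m); values of [x] and [y] at other
   indices are irrelevant. *)
Definition sym_vertices (R : realType) (m : nat) (x y : nat -> R) :
    seq (R * R) :=
  [seq (x i, y i) | i <- iota 1 m] ++ [seq - (x i, y i) | i <- iota 1 m].

Definition sym_polygon (R : realType) (m : nat) (x y : nat -> R) :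
    set (R * R) :=
  co [set` sym_vertices m x y].

Record class_S (R : realType) (m : nat) (x y : nat -> R) : Prop := ClassS {
  class_S_m : (3 <= m)%N;
  class_S_uniq : uniq (sym_vertices m x y);
  class_S_extreme :
    extreme_points (sym_polygon m x y) = [set` sym_vertices m x y];
  class_S_ccw : counter_clockwise (sym_vertices m x y);
  class_S_x : x 3%N <= x 2%N <= x 1%N;
  class_S_y1 : 0 <= y 1%N;
  class_S_y13 : y 1%N = y 3%N;
  class_S_y32 : y 3%N < y 2%N }.

(* S(t) *)
Definition slide (R : realType) (m : nat) (x y : nat -> R) (t : R) :
    set (R * R) :=
  sym_polygon m [eta x with 2%N |-> t] y.

Definition is_xi_l (R : realType) (m : nat) (x y : nat -> R) (xi : R) : Prop :=
  segment (xi, y 2%N) (if m == 3%N then - (x 1%N, y 1%N) else (x 4%N, y 4%N))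
    (x 3%N, y 3%N).

Definition is_xi_r (R : realType) (m : nat) (x y : nat -> R) (xi : R) : Prop :=
  segment (xi, y 2%N) (- (x m, y m)) (x 1%N, y 1%N).

(* Main.v *)
Require Import Defs.
From HB Require Import structures.
From mathcomp Require Import all_boot all_order all_algebra.
From mathcomp Require Import all_classical all_reals all_analysis measurable_realfun.
From mathcomp Require Import ring lra.

Set Implicit Arguments.
Unset Strict Implicit.
Unset Printing Implicit Defensive.

Import Order.TTheory GRing.Theory Num.Theory.
Import numFieldNormedType.Exports.

Local Open Scope classical_set_scope.
Local Open Scope ring_scope.

(** All the polygons S(t), for t between xi_l and xi_r, are images of one another
    under shears.  Write h = y_1 = y_3 and H = y_2, and let the profile s be the
    odd function of the height that vanishes on [-h, h] and equals
    (v - h) / (H - h) for v >= h.  Then the map (u, v) |-> (u + (t - t') s(v), v)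
    carries S(t') onto S(t) (lemma [slideE]).  Indeed the apex (t, H) lies on the
    inner side of the two lines that carry the neighbours of the top edge, from
    (x_1, h) to (x_3, h), of the hull P of the vertices that do not slide.  So a
    segment from the apex to P enters P through its top edge.  Hence S(t) is the
    union of P, which lies in the strip of heights [-h, h] and does not move, of
    the triangle with apex (t, H) on the top edge of P, on which the shear is
    affine, and of the opposite triangle (lemma [slide_cap]).

    A shear preserves area ([mu2_shear]), and by symmetry S(t) has its centroid at
    the origin, so that, with A = |S(t)| and integrals over S = S(x_2), and with
    tau = t - x_2,
      1 / C(S(t)) = ((int (u + tau s)^2) (int v^2) - (int (u + tau s) v)^2) / A^4
    ([calC_inv], [calC_shear]).  This is a polynomial of degree at most 2 in t whose
    leading coefficient is ((int s^2) (int v^2) - (int s v)^2) / A^4.  That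
    coefficient is positive by the strict Cauchy-Schwarz inequality
    ([cauchy_schwarz_strict]): on the upper triangle s is an affine function of v
    with nonzero constant term since h > 0, so that s and v are not proportional. *)

(** * Convex hulls in coordinates *)

Section ConvexHulls.
Variable R : realType.
Implicit Types (a b p z : R * R) (A B : set (R * R)).

Definition mix (k : R) (a b : R * R) : R * R :=
  (k * a.1 + (1 - k) * b.1, k * a.2 + (1 - k) * b.2).

Definition cvx (A : set (R * R)) : Prop :=
  forall k a b, 0 <= k <= 1 -> A a -> A b -> A (mix k a b).

Lemma convex_setP A : convex_set (A : set (convex_lmodType (R * R)%type)) <-> cvx A.
Proof.
split=> [cA k a b /andP[k0 k1] Aa Ab|cA a b k /set_mem Aa /set_mem Ab].
  by have := cA a b (Itv01 k0 k1) (mem_set Aa) (mem_set Ab); rewrite inE.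
apply/mem_set; apply: cA => //; exact/andP.
Qed.

Lemma segmentP a b z : segment a b z -> exists2 k, 0 <= k <= 1 & z = mix k a b.
Proof. by case=> k ->; exists k%:num => //; apply/andP. Qed.

Lemma co_cvx A : cvx (co A).
Proof.
move=> k a b k01 Aa Ab B [cB AB]; move/convex_setP: (cB); apply=> //; [exact: Aa|exact: Ab].
Qed.

Lemma sub_co A : A `<=` co A.
Proof. by move=> z Az B [_]; apply. Qed.

Lemma co_min A B : cvx B -> A `<=` B -> co A `<=` B.
Proof. by move=> cB AB z; apply; split => //; exact/convex_setP. Qed.

Lemma co_opp A : (forall z, A z -> A (- z)) -> forall z, co A z -> co A (- z).
Proof.
move=> Aopp; apply: (@co_min _ [set z | co A (- z)]) => [k a b k01 Aa Ab|z Az] /=.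
  have := co_cvx k01 Aa Ab; congr (co A _).
  by rewrite /mix; congr (_, _) => /=; ring.
by apply: sub_co; exact: Aopp.
Qed.

Definition cone p A : set (R * R) :=
  [set z | exists k q, [/\ 0 <= k <= 1, A q & z = mix k p q]].

(** A combination of two points of the cone is p plus weights m1 and m2 on two
    points of A; it has weight 1 - m on p and weight m on their barycentre,
    where m = m1 + m2.  If m = 0 there is no barycentre and the combination is p. *)
Lemma cone_cvx p A : cvx A -> cvx (cone p A).
Proof.
move=> cA l _ _ l01 [k [q [k01 Aq ->]]] [k' [q' [k01' Aq' ->]]].
pose m := l * (1 - k) + (1 - l) * (1 - k').
have m0 : 0 <= m by rewrite /m; nra.
have m1 : m <= 1 by rewrite /m; nra.
have [mE|mN] := eqVneq m 0.
  exists 1, q; split; rewrite ?lexx ?ler01//.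
  have h1 : l * (1 - k) = 0 by rewrite /m in mE; nra.
  have h2 : (1 - l) * (1 - k') = 0 by rewrite /m in mE; nra.
  have split_sum (u v w : R) :
    l * (k * u + (1 - k) * v) + (1 - l) * (k' * u + (1 - k') * w) =
    (1 - l * (1 - k) - (1 - l) * (1 - k')) * u
      + l * (1 - k) * v + (1 - l) * (1 - k') * w by ring.
  by rewrite /mix; congr (_, _) => /=; rewrite split_sum h1 h2; ring.
exists (1 - m), (mix (l * (1 - k) / m) q q'); split.
- by apply/andP; split; lra.
- apply: cA => //.
  have mp : 0 < m by rewrite lt_neqAle eq_sym mN.
  apply/andP; split; first by apply: divr_ge0 => //; nra.
  by rewrite ler_pdivrMr // mul1r /m; nra.
- by rewrite /mix; congr (_, _) => /=; rewrite /m in mN *; field.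
Qed.

Lemma cone_apex p A q : A q -> cone p A p.
Proof.
move=> Aq; exists 1, q; split=> //; first by rewrite lexx ler01.
by case: p => ? ?; rewrite /mix /=; congr (_, _); ring.
Qed.

Lemma sub_cone p A : A `<=` cone p A.
Proof.
move=> [q1 q2] Aq; exists 0, (q1, q2); split=> //; first by rewrite lexx ler01.
by rewrite /mix /=; congr (_, _); ring.
Qed.

End ConvexHulls.

(** * Measurability of polygons *)

Section PlaneMeasurability.
Variable R : realType.
Implicit Types (p z : R * R) (A U : set (R * R)).

(** The measurable sets of the plane are generated by products, so an open set
    has to be exhibited as a countable union of boxes: those with rational centre
    and radius that it contains. *)
Lemma open_measurable_plane U : open U -> measurable U.
Proof.
move=> oU.
pose box (i : rat * rat * rat) : set (R * R) :=
  ball (ratr i.1.1 : R) (ratr i.2) `*` ball (ratr i.1.2 : R) (ratr i.2).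
have -> : U = \bigcup_i (if `[< box i `<=` U >] then box i else set0).
  apply/seteqP; split=> [z Uz|z [i _]]; last by case: asboolP => // /(_ z).
  have /nbhs_ballP[e /= e0 zeU] : nbhs z U by exact: open_nbhs_nbhs.
  have e2 : 0 < e / 2 by lra.
  have /rat_in_itvoo[r] := e2; rewrite in_itv /= => /andP[r0 r1].
  have rat_near (t : R) : exists q, `|ratr q - t| < ratr r.
    have /rat_in_itvoo[q] : t - ratr r < t + ratr r by lra.
    by rewrite in_itv /= => qt; exists q; rewrite ltr_distl.
  have [q1 q1z] := rat_near z.1; have [q2 q2z] := rat_near z.2.
  exists (q1, q2, r) => //; rewrite ifT; first by split.
  apply/asboolP => w [/= w1 w2]; apply: zeU.
  (* w and z are both within r < e / 2 of the centre of the box *)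
  have half (a b c : R) : `|a - b| < ratr r -> `|a - c| < ratr r -> `|b - c| < e.
    by rewrite !ltr_distl => /andP[? ?] /andP[? ?]; apply/andP; split; lra.
  by split; [exact: (half (ratr q1))|exact: (half (ratr q2))].
apply: countable_bigcupT_measurable => // i; case: ifPn => // _.
by apply: measurableX; rewrite ball_itv; exact: measurable_itv.
Qed.

Lemma compact_measurable_plane A : compact A -> measurable A.
Proof.
move=> cA; rewrite -[A]setCK; apply: measurableC; apply: open_measurable_plane.
apply: closed_openC; apply: compact_closed => //.
Qed.

Lemma compact_coordinates A : compact A ->
  exists M : R, forall z, A z -> `|z.1| <= M /\ `|z.2| <= M.
Proof.
move=> /compact_bounded[M [_ /(_ (M + 1))]] AM; exists (M + 1) => z Az.
have M1 : M < M + 1 by lra.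
by have /= := AM M1 z Az; rewrite prod_normE ge_max => /andP.
Qed.

Lemma cone_compact p A : compact A -> compact (cone p A).
Proof.
move=> cA; pose f (u : R * (R * R)) := u.1 *: p + (1 - u.1) *: u.2.
have -> : cone p A = f @` (`[0, 1]%classic `*` A).
  apply/seteqP; split=> [z [k [q [k01 Aq ->]]]|z [[k q] [/= k01 Aq] <-]].
    by exists (k, q) => //; split=> //=; rewrite in_itv.
  by exists k, q; split=> //; move: k01; rewrite in_itv.
apply: continuous_compact; last by apply: compact_setX => //; exact: segment_compact.
apply: continuous_subspaceT => u; apply: cvgD; apply: cvgZ.
- exact: cvg_fst.
- exact: cvg_cst.
- by apply: cvgB; [exact: cvg_cst|exact: cvg_fst].
- exact: cvg_snd.
Qed.

(** The hull of a nonempty finite set is an iterated cone, and a cone is a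
    continuous image of a product with the unit interval. *)
Lemma co_seq_compact (a : R * R) (l : seq (R * R)) : compact (co [set` a :: l]).
Proof.
elim: l a => [|b l IH] a.
  rewrite (_ : co _ = [set a]); first exact: compact_set1.
  apply/seteqP; split; last first.
    by move=> _ ->; apply: sub_co; rewrite /= mem_head.
  apply: co_min => [k _ _ _ -> ->|z /=]; last by rewrite inE => /eqP.
  by case: a => a1 a2; rewrite /mix /=; congr (_, _); ring.
rewrite (_ : co _ = cone a (co [set` b :: l])); first exact: cone_compact.
apply/seteqP; split.
  apply: co_min; first by apply: cone_cvx; exact: co_cvx.
  move=> z /=; rewrite inE => /orP[/eqP ->|zl].
    by apply: (@cone_apex _ _ _ b); apply: sub_co; rewrite /= mem_head.
  by apply: sub_cone; exact: sub_co.
move=> _ [k [q [k01 Aq ->]]]; apply: co_cvx => //.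
  by apply: sub_co; rewrite /= mem_head.
apply: co_min Aq; first exact: co_cvx.
by move=> z zl; apply: sub_co; rewrite /= inE; apply/orP; right.
Qed.

End PlaneMeasurability.

(** * Cones over a symmetric convex set *)

Section ConeGeometry.
Variable R : realType.
Implicit Types (a b p q r z : R * R) (A P : set (R * R)).

Lemma orientation_mix a b k p q :
  orientation a b (mix k p q) = k * orientation a b p + (1 - k) * orientation a b q.
Proof. by rewrite /orientation /mix /=; ring. Qed.

Lemma orientation_cycle a b c : orientation a b c = orientation b c a.
Proof. by rewrite /orientation; ring. Qed.

Lemma halfplane_cvx a b : cvx [set z | 0 <= orientation a b z].
Proof. by move=> k p q /andP[k0 k1] /= pa qa; rewrite orientation_mix; nra. Qed.

Lemma lower_halfplane_cvx (h : R) : cvx [set z : R * R | z.2 <= h].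
Proof. by move=> k p q /andP[k0 k1] /= pa qa; nra. Qed.

(** In a combination of p, - p and a point q of A, the opposite weights on p and
    - p cancel against each other, leaving only the larger one; the lost weight
    goes to 0, which belongs to A.  So one never has to know how the cone over p
    sits relative to the cone over - p. *)
Lemma cone_cone_opp p A z : cvx A -> A 0 -> (forall q, A q -> A (- q)) ->
  cone p (cone (- p) A) z -> cone p A z \/ cone p A (- z).
Proof.
move=> cA A0 Aopp [k [_ [/andP[k0 k1] [l [q [/andP[l0 l1] Aq ->]]] ->]]].
have star c : 0 <= c <= 1 -> forall w, A w -> A (c * w.1, c * w.2).
  move=> c01 w Aw; have := cA c w 0 c01 Aw A0.
  by rewrite /mix /=; congr (A (_, _)); ring.
have key (c d : R) w : 0 <= c -> 0 <= d -> c + d <= 1 -> A w ->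
    cone p A (c * p.1 + d * w.1, c * p.2 + d * w.2).
  move=> c0 d0 cd Aw.
  have [cE|cN] := eqVneq c 1.
    have -> : d = 0 by lra.
    rewrite cE (_ : (_, _) = p); first exact: (cone_apex _ A0).
    by case: (p) => ? ? /=; congr (_, _); ring.
  have c1 : 0 < 1 - c by rewrite subr_gt0 lt_neqAle cN /=; lra.
  exists c, (d / (1 - c) * w.1, d / (1 - c) * w.2); split.
  - by apply/andP; split=> //; lra.
  - apply: star => //; apply/andP; split; first by apply: divr_ge0 => //; lra.
    by rewrite ler_pdivrMr //; lra.
  - by rewrite /mix /=; congr (_, _); field; lra.
have kl : 0 <= (1 - k) * l <= 1 - k by apply/andP; split; nra.
case/andP: kl => kl0 kl1.
have [le|/ltW le] := leP ((1 - k) * l) k; [left|right].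
  have := @key (k - (1 - k) * l) ((1 - k) * (1 - l)) q.
  rewrite (_ : (_, _) = mix k p (mix l (- p) q)).
    by apply=> //; [lra|nra|nra].
  by rewrite /mix /=; congr (_, _); ring.
have := @key ((1 - k) * l - k) ((1 - k) * (1 - l)) (- q).
rewrite (_ : (_, _) = - mix k p (mix l (- p) q)).
  by apply=> //; [lra|nra|nra|exact: Aopp].
by rewrite /mix /=; congr (_, _) => /=; ring.
Qed.

(** Cutting a cone at height [h], between its base and its apex: on the segment
    from q to p the point of height h has parameter c; a point with smaller
    parameter lies between two points of P, one with larger parameter lies above
    the cut. *)
Lemma cone_above P p (h : R) z : cvx P -> (forall q, P q -> q.2 <= h) -> h < p.2 ->
    (forall q k, P q -> 0 <= k <= 1 -> (mix k p q).2 = h -> P (mix k p q)) ->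
  cone p P z ->
  P z \/ exists k r, [/\ 0 <= k <= 1, P r, r.2 = h & z = mix k p r].
Proof.
move=> cP Ph hp cross [k [q [/andP[k0 k1] Pq ->]]].
have qh := Ph _ Pq.
have d0 : 0 < p.2 - q.2 by lra.
pose c := (h - q.2) / (p.2 - q.2).
have c0 : 0 <= c by apply: divr_ge0; lra.
have c1 : c < 1 by rewrite ltr_pdivrMr //; lra.
have rh : (mix c p q).2 = h by rewrite /mix /c /=; field; lra.
have Pr : P (mix c p q) by apply: cross => //; rewrite c0 ltW.
have [kc|ck] := leP k c.
  left; have [cE|cN] := eqVneq c 0.
    have -> : mix k p q = q; last by [].
    have -> : k = 0 by lra.
    by case: (q) => ? ?; rewrite /mix /=; congr (_, _); ring.
  have cp : 0 < c by rewrite lt_neqAle eq_sym cN.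
  have := cP (k / c) _ _ _ Pr Pq; rewrite (_ : mix _ _ _ = mix k p q); last first.
    by rewrite /mix /=; congr (_, _); field.
  apply; apply/andP; split; first exact: divr_ge0.
  by rewrite ler_pdivrMr // mul1r.
right; exists ((k - c) / (1 - c)), (mix c p q); split=> //.
- apply/andP; split; first by apply: divr_ge0; lra.
  by rewrite ler_pdivrMr; lra.
- by rewrite /mix /=; congr (_, _); field; lra.
Qed.

End ConeGeometry.

(** * The sliding polygons and the shear *)

Section SlidingPolygon.
Variable R : realType.
Implicit Types (x y : nat -> R) (z : R * R).

Definition fixed_vertices m x y : set (R * R) :=
  [set v | exists i, [/\ (1 <= i <= m)%N, i != 2%N &
                      v = (x i, y i) \/ v = - (x i, y i)]].

(** The part of the sliding polygon that does not depend on t. *)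
Definition core m x y : set (R * R) := co (fixed_vertices m x y).

(** For 0 <= h < H: the odd function that is zero on [-h, h] and affine beyond,
    with value 1 at H. *)
Definition profile (h H v : R) : R :=
  (Num.max (v - h) 0 - Num.max (- v - h) 0) / (H - h).

Definition shear (g : R -> R) (z : R * R) : R * R := (z.1 + g z.2, z.2).

Lemma mem_sym_vertices m x y v : v \in sym_vertices m x y <->
  exists2 i, (1 <= i <= m)%N & v = (x i, y i) \/ v = - (x i, y i).
Proof.
rewrite /sym_vertices mem_cat; split.
  case/orP=> /mapP[i]; rewrite mem_iota add1n ltnS => im ->.
    by exists i => //; left.
  by exists i => //; right.
case=> i im [->|->]; apply/orP; [left|right]; apply/mapP; exists i => //;
  by rewrite mem_iota add1n ltnS.
Qed.

Lemma nth_sym_vertices m x y k : (k < m)%N ->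
  nth 0 (sym_vertices m x y) k = (x k.+1, y k.+1) /\
  nth 0 (sym_vertices m x y) (m + k) = - (x k.+1, y k.+1).
Proof.
move=> km; rewrite /sym_vertices !nth_cat size_map size_iota km ltnNge leq_addr /=.
by rewrite addKn !(nth_map 0%N) ?size_iota // !nth_iota // add1n.
Qed.

Lemma size_sym_vertices m x y : size (sym_vertices m x y) = (m + m)%N.
Proof. by rewrite size_cat !size_map size_iota. Qed.

Lemma core_opp m x y z : core m x y z -> core m x y (- z).
Proof.
apply: co_opp => _ [i [im i2 [->|->]]]; exists i; split=> //; first by right.
by left; rewrite opprK.
Qed.

Lemma slide_opp m x y t z : slide m x y t z -> slide m x y t (- z).
Proof.
apply: co_opp => _ /= /mem_sym_vertices[i im [->|->]];
  apply/mem_sym_vertices; exists i => //; first by right.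
by left; rewrite opprK.
Qed.

Lemma core_sub_slide m x y t : core m x y `<=` slide m x y t.
Proof.
apply: co_min; first exact: co_cvx.
move=> v [i [im i2 vE]]; apply: sub_co; apply/mem_sym_vertices; exists i => //=.
by rewrite (negPf i2).
Qed.

Lemma slide_apex m x y t : (2 <= m)%N -> slide m x y t (t, y 2%N).
Proof.
move=> m2; apply: sub_co; apply/mem_sym_vertices; exists 2%N => //=.
by left.
Qed.

Lemma slide_sub_cone m x y t : (1 <= m)%N ->
  slide m x y t `<=` cone (t, y 2%N) (cone (- (t, y 2%N)) (core m x y)).
Proof.
move=> m1.
have c1 : core m x y (x 1%N, y 1%N).
  by apply: sub_co; exists 1%N; split=> //; left.
apply: co_min; first by do 2 apply: cone_cvx; exact: co_cvx.
move=> v /mem_sym_vertices[i im] /=; have [->|i2] := eqVneq i 2%N => vE.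
  case: vE => ->; first by apply: cone_apex; exact: (cone_apex _ c1).
  by apply: sub_cone; exact: (cone_apex _ c1).
by do 2 apply: sub_cone; apply: sub_co; exists i.
Qed.

Lemma profile_low h H v : 0 <= h -> `|v| <= h -> profile h H v = 0.
Proof.
move=> h0; rewrite ler_norml => /andP[v1 v2].
rewrite /profile !max_r; first by rewrite subrr mul0r.
all: lra.
Qed.

Lemma profile_high h H v : 0 <= h -> h <= v -> profile h H v = (v - h) / (H - h).
Proof.
move=> h0 hv; rewrite /profile max_l ?max_r ?subr0 //; lra.
Qed.

Lemma profileN h H v : profile h H (- v) = - profile h H v.
Proof. by rewrite /profile opprK -mulNr opprB. Qed.

End SlidingPolygon.

(** * The shape of a polygon of the class near its top edge *)

Section ClassS.
Variables (R : realType) (m : nat) (x y : nat -> R).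
Hypothesis hS : class_S m x y.

Local Notation V := (nth 0 (sym_vertices m x y)).

(** From here on vertices are numbered from 0 as in the list, so the sliding
    vertices have indices 1 and m + 1. *)
Lemma vertices_ccw i j k : (i < j)%N -> (j < k)%N -> (k < m + m)%N ->
  0 < orientation (V i) (V j) (V k).
Proof. by move=> ij jk km; apply: (class_S_ccw hS) => //; rewrite size_sym_vertices. Qed.

Let m3 : (3 <= m)%N := class_S_m hS.

Lemma vertex0 : V 0 = (x 1%N, y 1%N).
Proof. by have [] := @nth_sym_vertices R m x y 0 (ltnW (ltnW m3)). Qed.

Lemma vertex2 : V 2 = (x 3%N, y 1%N).
Proof. by rewrite (class_S_y13 hS); have [] := @nth_sym_vertices R m x y 2 m3. Qed.

Lemma vertex3 : V 3 = if m == 3%N then - (x 1%N, y 1%N) else (x 4%N, y 4%N).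
Proof.
case: ifPn => [/eqP mE|m3'].
  have [_] := @nth_sym_vertices R m x y 0 (ltnW (ltnW m3)).
  by rewrite addn0 => <-; rewrite mE.
have m4 : (3 < m)%N by rewrite ltn_neqAle eq_sym m3'.
by have [] := @nth_sym_vertices R m x y 3 m4.
Qed.

Lemma vertex_last : V (m + m).-1 = - (x m, y m).
Proof.
have m0 : (0 < m)%N by exact: ltn_trans m3.
have mm : (m.-1 < m)%N by rewrite prednK.
have [_] := @nth_sym_vertices R m x y _ mm.
by rewrite prednK //; congr (nth _ _ _ = _); rewrite -!subn1 addnBA.
Qed.

Lemma fixed_index v : fixed_vertices m x y v ->
  exists k, [/\ (k < m + m)%N, k != 1%N & v = V k].
Proof.
case=> -[|i] [/andP[// i0 im] i2 vE].
have [E1 E2] := @nth_sym_vertices R m x y i im.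
case: vE => ->; [exists i|exists (m + i)%N]; split=> //.
- by rewrite ltn_addl.
- by rewrite ltn_add2l.
- by rewrite neq_ltn (leq_trans _ (leq_addr i m)) ?orbT // ltnW.
Qed.

(** For vertices of equal height the orientation of a triangle is the product of
    the width x_3 - x_1 and of the height of the third vertex above them: it is
    positive, so x_3 <> x_1.  The same product puts every later vertex under the
    top edge, in [below_top]. *)
Lemma top_edge_lt : x 3%N < x 1%N.
Proof.
have := @vertices_ccw 0 2 3 isT isT (leq_trans (isT : (3 < 3 + 3)%N) (leq_add m3 m3)).
rewrite vertex0 vertex2 /orientation /= subrr mul0r subr0 => h.
have /andP[x32 x21] := class_S_x hS.
by rewrite lt_neqAle (le_trans x32 x21) andbT; apply: contraTneq h => ->; rewrite subrr mul0r ltxx.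
Qed.

Lemma below_top k : (2 < k)%N -> (k < m + m)%N -> (V k).2 < y 1%N.
Proof.
move=> k2 km; have := @vertices_ccw 0 2 k isT k2 km.
rewrite vertex0 vertex2 /orientation /= subrr mul0r subr0.
by rewrite nmulr_rgt0 ?subr_lt0 // top_edge_lt.
Qed.

(** The vertex opposite to the first one is strictly below the top edge. *)
Lemma top_height_gt0 : 0 < y 1%N.
Proof.
have [_] := @nth_sym_vertices R m x y 0 (ltnW (ltnW m3)); rewrite addn0 => E.
have m0 : (0 < m)%N by exact: ltn_trans m3.
have := @below_top m m3; rewrite E /= -[X in (X < _)%N]addn0 ltn_add2l.
by move/(_ m0) => ?; lra.
Qed.

Lemma core_le z : core m x y z -> z.2 <= y 1%N.
Proof.
apply: (co_min (@lower_halfplane_cvx R (y 1%N))) => {}z /fixed_index[[|[|[|k]]] [km k1 ->]] //=.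
- by rewrite vertex0.
- by rewrite vertex2.
- exact/ltW/below_top.
Qed.

(** Counter-clockwise order says that the polygon lies to the left of each of its
    edges, here one of the two neighbours of the top edge. *)
Lemma core_left z : core m x y z -> 0 <= orientation (V 2) (V 3) z.
Proof.
apply: (co_min (@halfplane_cvx R (V 2) (V 3))) => {}z /fixed_index[k [km k1 ->]] /=.
have [k4|] := leqP 4 k; first by apply/ltW/vertices_ccw.
case: k km k1 => [|[|[|[|]]]] // km _ _.
- by rewrite -orientation_cycle; apply/ltW/vertices_ccw => //; exact: leq_trans (leq_add m3 m3).
- by rewrite /orientation subrr mulr0 subrr mulr0 subr0.
- by rewrite /orientation mulrC subrr.
Qed.

Lemma core_right z : core m x y z -> 0 <= orientation (V (m + m).-1) (V 0) z.
Proof.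
apply: (co_min (@halfplane_cvx R (V (m + m).-1) (V 0))) => {}z /fixed_index[k [km k1 ->]] /=.
have m0 : (0 < m + m)%N by exact: leq_ltn_trans km.
have [->|k0] := posnP k; first by rewrite /orientation mulrC subrr.
have : (k <= (m + m).-1)%N by rewrite -ltnS prednK.
rewrite leq_eqVlt => /orP[/eqP ->|kl].
  by rewrite /orientation subrr mulr0 subrr mulr0 subr0.
rewrite orientation_cycle; apply/ltW/vertices_ccw => //; by rewrite prednK.
Qed.

Variables (xi_l xi_r : R).
Hypotheses (hl : is_xi_l m x y xi_l) (hr : is_xi_r m x y xi_r).

(** The relation b.2 < a.2 excludes the degenerate position a = b, in which the
    segment condition would say nothing about xi. *)
Lemma xi_on_line a b (xi h : R) : segment (xi, h) b a -> b.2 < a.2 ->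
  orientation a b (xi, h) = 0.
Proof.
move=> /segmentP[k /andP[k0 _] aE] ba.
have kN : k != 0.
  by apply: contraTneq ba => k0'; rewrite aE k0' /mix /= mul0r add0r subr0 mul1r ltxx.
have aa : orientation a b a = 0 by rewrite /orientation; ring.
have bb : orientation a b b = 0 by rewrite /orientation; ring.
have := orientation_mix a b k (xi, h) b; rewrite -aE aa bb mulr0 addr0.
by move/esym/eqP; rewrite mulf_eq0 (negPf kN) => /eqP.
Qed.

(** The orientation is affine in t and vanishes at xi_l, so its sign tells on
    which side of xi_l the apex is. *)
Lemma xi_left t : orientation (V 2) (V 3) (t, y 2%N) = (y 1%N - (V 3).2) * (t - xi_l).
Proof.
have m6 : (3 < m + m)%N := leq_trans (isT : (3 < 3 + 3)%N) (leq_add m3 m3).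
have : orientation (V 2) (V 3) (xi_l, y 2%N) = 0.
  apply: xi_on_line; last by rewrite [in ltRHS]vertex2 below_top.
  rewrite vertex3 (_ : V 2 = (x 3%N, y 3%N)); first exact: hl.
  by rewrite vertex2 (class_S_y13 hS).
rewrite /orientation [in V 2]vertex2 /= => E.
by apply/eqP; rewrite -subr_eq0 -[X in _ == X]E; apply/eqP; ring.
Qed.

Lemma xi_right t : orientation (V (m + m).-1) (V 0) (t, y 2%N) =
  (y 1%N - (V (m + m).-1).2) * (xi_r - t).
Proof.
have m6 : (5 < m + m)%N := leq_add m3 m3.
have : orientation (V 0) (V (m + m).-1) (xi_r, y 2%N) = 0.
  apply: xi_on_line; first by rewrite vertex0 vertex_last.
  rewrite [in ltRHS]vertex0 below_top //; last by rewrite prednK // (ltn_trans _ m6).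
  by rewrite -ltnS prednK ?(ltn_trans _ m6).
rewrite /orientation [in V 0]vertex0 /= => E.
by apply/eqP; rewrite -subr_eq0 -[X in _ == X]oppr0 -E; apply/eqP; ring.
Qed.

(** So x_2 is an admissible value of t, and S can serve as the reference polygon. *)
Lemma xi_bounds : xi_l < x 2%N < xi_r.
Proof.
have m6 : (5 < m + m)%N := leq_add m3 m3.
have m0 : (0 < m)%N by exact: ltn_trans m3.
have V1 : V 1 = (x 2%N, y 2%N) by have [] := @nth_sym_vertices R m x y 1 (ltnW m3).
have V3y : (V 3).2 < y 1%N by rewrite below_top // (ltn_trans _ m6).
have Vly : (V (m + m).-1).2 < y 1%N.
  by rewrite below_top // ?prednK ?(ltn_trans _ m6) // -ltnS prednK ?(ltn_trans _ m6).
apply/andP; split.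
  have := @vertices_ccw 1 2 3 isT isT (ltn_trans (isT : (3 < 5)%N) m6).
  by rewrite orientation_cycle V1 xi_left pmulr_rgt0 ?subr_gt0.
have := @vertices_ccw 0 1 (m + m).-1 isT.
rewrite -orientation_cycle V1 xi_right prednK ?(ltn_trans _ m6) // pmulr_rgt0 ?subr_gt0 //.
by apply=> //; rewrite -ltnS prednK ?(ltn_trans _ m6).
Qed.

Lemma top_edge_core (s : R) : x 3%N <= s <= x 1%N -> core m x y (s, y 1%N).
Proof.
move=> /andP[s3 s1].
have c1 : core m x y (x 1%N, y 1%N).
  by apply: sub_co; exists 1%N; split=> //; [rewrite (ltn_trans _ m3)|left].
have c3 : core m x y (x 3%N, y 1%N).
  by apply: sub_co; exists 3%N; split=> //; left; rewrite (class_S_y13 hS).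
have d := top_edge_lt.
have := @co_cvx R _ ((s - x 3%N) / (x 1%N - x 3%N)) _ _ _ c1 c3.
rewrite (_ : mix _ _ _ = (s, y 1%N)).
  apply; apply/andP; split; first by apply: divr_ge0; lra.
  by rewrite ler_pdivrMr; lra.
by rewrite /mix /=; congr (_, _); field; lra.
Qed.

Lemma core0 : core m x y 0.
Proof.
have c1 : core m x y (x 1%N, y 1%N).
  by apply: top_edge_core; rewrite lexx ltW // top_edge_lt.
have := @co_cvx R _ (1 / 2) _ _ _ c1 (core_opp c1).
by rewrite (_ : mix _ _ _ = 0); [apply; lra | rewrite /mix /=; congr (_, _); field].
Qed.

(** The decomposition of S(t) into the fixed core and two opposite triangles.  A
    point of height h on a segment from the apex to the core is on the inner side
    of both edges adjacent to the top one, because both endpoints are; on the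
    line of height h this leaves only the top edge. *)
Lemma slide_cap t z : xi_l <= t <= xi_r -> slide m x y t z ->
  exists2 w, z = w \/ z = - w & core m x y w \/
    exists k r, [/\ 0 <= k <= 1, core m x y r, r.2 = y 1%N & w = mix k (t, y 2%N) r].
Proof.
move=> /andP[tl tr] zS.
have m6 : (5 < m + m)%N := leq_add m3 m3.
have m0 : (0 < m)%N by exact: ltn_trans m3.
have V3y : (V 3).2 < y 1%N by rewrite below_top // (ltn_trans _ m6).
have Vly : (V (m + m).-1).2 < y 1%N.
  by rewrite below_top // ?prednK ?(ltn_trans _ m6) // -ltnS prednK ?(ltn_trans _ m6).
have y12 : y 1%N < y 2%N by rewrite (class_S_y13 hS) (class_S_y32 hS).
have above w : cone (t, y 2%N) (core m x y) w ->
    core m x y w \/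
    exists k r, [/\ 0 <= k <= 1, core m x y r, r.2 = y 1%N & w = mix k (t, y 2%N) r].
  apply: cone_above => //; [exact: co_cvx|exact: core_le|].
  move=> q k Pq /andP[k0 k1]; have := core_left Pq; have := core_right Pq.
  set r := mix k _ q => qr ql rh.
  have : 0 <= orientation (V 2) (V 3) r.
    by rewrite orientation_mix xi_left addr_ge0 // !mulr_ge0 //; lra.
  have : 0 <= orientation (V (m + m).-1) (V 0) r.
    by rewrite orientation_mix xi_right addr_ge0 // !mulr_ge0 //; lra.
  rewrite (surjective_pairing r) rh => {qr ql}.
  rewrite [in V 0]vertex0 [in V 2]vertex2 /orientation /= => hR hL.
  by apply: top_edge_core; apply/andP; split; nra.
have [] := cone_cone_opp (@co_cvx R _) core0 (@core_opp _ _ _ _)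
  (slide_sub_cone (ltnW (ltnW m3)) zS).
  by move/above; exists z => //; left.
by move/above; exists (- z) => //; right; rewrite opprK.
Qed.

Lemma core_height z : core m x y z -> `|z.2| <= y 1%N.
Proof.
by move=> zc; rewrite ler_norml core_le // lerNl andbT; exact: (core_le (core_opp zc)).
Qed.

(** On the core the profile vanishes; on the upper triangle the profile of
    k (t, H) + (1 - k) r is k, so that the shear replaces t by u in this
    combination. *)
Lemma slide_shear_sub t u z : xi_l <= t <= xi_r ->
  slide m x y t z ->
  slide m x y u (shear (fun v => (u - t) * profile (y 1%N) (y 2%N) v) z).
Proof.
move=> ht zS; have h0 := ltW top_height_gt0.
have y12 : y 1%N < y 2%N by rewrite (class_S_y13 hS) (class_S_y32 hS).
have [w zw wS] := slide_cap ht zS.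
suff sw : slide m x y u (shear (fun v => (u - t) * profile (y 1%N) (y 2%N) v) w).
  case: zw => -> //; have := slide_opp sw; rewrite /shear /= profileN.
  by congr (slide _ _ _ _ _); congr (_, _) => /=; ring.
case: wS => [wc|[k [r [/andP[k0 k1] rc rh ->]]]].
  rewrite /shear profile_low ?core_height // mulr0 addr0 -surjective_pairing.
  exact: core_sub_slide.
have kE : (mix k (t, y 2%N) r).2 = y 1%N + k * (y 2%N - y 1%N) by rewrite /mix /= rh; ring.
rewrite /shear kE profile_high //; last by nra.
have k01 : 0 <= k <= 1 by rewrite k0.
rewrite [X in slide _ _ _ _ X](_ : _ = mix k (u, y 2%N) r).
  exact: (co_cvx k01 (@slide_apex R m x y u (ltnW m3)) (@core_sub_slide R m x y u r rc)).
by rewrite /mix /= rh; congr (_, _); field; lra.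
Qed.

Lemma slideE t u : xi_l <= t <= xi_r -> xi_l <= u <= xi_r ->
  slide m x y u =
  shear (fun v => (t - u) * profile (y 1%N) (y 2%N) v) @^-1` slide m x y t.
Proof.
move=> ht hu; apply/seteqP; split=> z /=; first exact: slide_shear_sub.
move/(@slide_shear_sub t u _ ht); congr (slide _ _ _ _ _).
by case: z => a b; rewrite /shear /=; congr (_, _); ring.
Qed.

End ClassS.

(** * Area-preserving maps of the plane *)

Section Invariance.
Variable R : realType.
Local Notation T := (measurableTypeR R).
Local Notation mu := (@lebesgue_measure R).
Implicit Types (A : set T) (K : set (T * T)).

Lemma lebesgue_measure_translate (c : R) A : measurable A ->
  mu ((fun v => v + c) @^-1` A) = mu A.
Proof.
have mf : measurable_fun [set: T] (fun v : T => v + c : T).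
  by apply: (@measurable_funD _ T R) => //; exact: measurable_cst.
move=> mA; apply/esym; rewrite -[RHS]/(pushforward mu (fun v : T => v + c : T) A).
apply: lebesgue_measure_unique => // _ [[a b] _ <-] /=; rewrite /pushforward.
rewrite (_ : _ @^-1` _ = `]a - c, b - c]%classic).
  rewrite !lebesgue_measure_itv /= !lte_fin ltrD2r.
  by case: ifP => // _; rewrite -!EFinB; congr (_%:E); ring.
by apply/seteqP; split=> v /=; rewrite !in_itv /= ltrBlDr lerBrDr.
Qed.

Lemma lebesgue_measure_reflect A : measurable A -> mu (-%R @^-1` A) = mu A.
Proof.
have mf : measurable_fun [set: T] (fun v : T => - v : T).
  by apply: (@measurable_funN _ T R).
move=> mA; apply/esym; rewrite -[RHS]/(pushforward mu (fun v : T => - v : T) A).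
apply: lebesgue_measure_unique => // _ [[a b] _ <-] /=; rewrite /pushforward.
rewrite (_ : _ @^-1` _ = `[- b, - a[%classic).
  rewrite !lebesgue_measure_itv /= !lte_fin ltrN2.
  by case: ifP => // _; rewrite -!EFinB; congr (_%:E); ring.
by apply/seteqP; split=> v /=; rewrite !in_itv /= lerNl ltrNr andbC.
Qed.

Lemma measurable_shear (g : R -> R) : measurable_fun [set: T] g ->
  measurable_fun [set: T * T] (shear g : T * T -> T * T).
Proof.
move=> mg; apply/measurable_fun_pairP; split; last exact: measurable_snd.
apply: (@measurable_funD _ _ R); first exact: measurable_fst.
by apply: measurableT_comp => //; exact: measurable_snd.
Qed.

Lemma measurable_opp_plane : measurable_fun [set: T * T] (-%R : T * T -> T * T).
Proof.
apply/measurable_fun_pairP; split; apply: (@measurable_funN _ _ R).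
  exact: measurable_fst.
exact: measurable_snd.
Qed.

(** Cavalieri: each horizontal section is translated.  The sections are horizontal,
    hence the product measure is first rewritten with the other order of
    integration. *)
Lemma mu2_shear (g : R -> R) K : measurable_fun [set: T] g -> measurable K ->
  mu2 R (shear g @^-1` K) = mu2 R K.
Proof.
move=> mg mK.
have swap (L : set (T * T)) : measurable L -> mu2 R L = (mu \x^ mu)%E L.
  by apply: product_measure_unique => A B mA mB; exact: product_measure2E.
have mS := measurable_shear mg.
rewrite !swap //; last by rewrite -[X in measurable X]setTI; exact: mS.
rewrite /product_measure2; apply: eq_integral => v _ /=.
rewrite (_ : ysection _ v = (fun u => u + g v) @^-1` ysection K v).
  by apply: lebesgue_measure_translate; exact: measurable_ysection.
by apply/seteqP; split=> u; rewrite /= !ysectionP.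
Qed.

Lemma mu2_opp K : measurable K -> mu2 R (-%R @^-1` K) = mu2 R K.
Proof.
have mf := measurable_opp_plane.
move=> mK; apply/esym; rewrite -[RHS]/(pushforward (mu2 R) (-%R : T * T -> T * T) K).
apply: product_measure_unique => // A B mA mB; rewrite /= /pushforward.
rewrite (_ : _ @^-1` _ = (-%R @^-1` A) `*` (-%R @^-1` B)) //.
rewrite product_measure1E; [|by rewrite -[X in measurable X]setTI; exact: measurable_funN..].
by congr (_ * _)%E; exact: lebesgue_measure_reflect.
Qed.

End Invariance.

(** * Second moments *)

Section Moments.
Variable R : realType.
Local Notation T := (measurableTypeR R).
Local Notation mu := (@lebesgue_measure R).
Implicit Types (B K : set (T * T)) (f g : T * T -> R).

(** A class of functions, integrable on sets of finite area, that is closed under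
    products. *)
Definition tame K f :=
  measurable_fun [set: T * T] f /\ exists M : R, forall z, K z -> `|f z| <= M.

Lemma tameM K f g : tame K f -> tame K g -> tame K (fun z => f z * g z).
Proof.
move=> [mf [M fM]] [mg [N gN]]; split; first exact: measurable_funM.
exists (M * N) => z Kz; rewrite normrM; apply: ler_pM => //; [exact: fM|exact: gN].
Qed.

Lemma tameD K f g : tame K f -> tame K g -> tame K (fun z => f z + g z).
Proof.
move=> [mf [M fM]] [mg [N gN]]; split; first exact: measurable_funD.
by exists (M + N) => z Kz; rewrite (le_trans (ler_normD _ _)) // lerD ?fM ?gN.
Qed.

Lemma tame_cst K (c : R) : tame K (fun=> c).
Proof. by split; [exact: measurable_cst|exists `|c|]. Qed.

Lemma bounded_mu2_fin K (M : R) :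
  measurable K -> (forall z, K z -> `|z.1| <= M /\ `|z.2| <= M) -> (mu2 R K < +oo)%E.
Proof.
move=> mK KM; pose I : set T := `[- M, M]%classic.
have mI : measurable I by exact: measurable_itv.
apply: (@le_lt_trans _ _ (mu2 R (I `*` I))).
  apply: le_measure; rewrite ?inE //; first exact: measurableX.
  by move=> z /KM[z1 z2]; split; rewrite /I /= in_itv /= -ler_norml.
rewrite product_measure1E //= /I lebesgue_measure_itv /= lte_fin.
by case: ifP => _; rewrite ?mule0 ?ltry // -EFinB -EFinM ltry.
Qed.

Lemma tame_integrable K f : measurable K -> (mu2 R K < +oo)%E -> tame K f ->
  (mu2 R).-integrable K (EFin \o f).
Proof.
move=> mK Kfin [mf [M fM]]; apply: measurable_bounded_integrable => //.
  exact: measurable_funTS.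
exists M; split; first exact: num_real.
by move=> N MN z Kz; exact: le_trans (fM _ Kz) (ltW MN).
Qed.

Lemma Rintegral_preserved (phi : T * T -> T * T) K f :
    measurable_fun setT phi -> (forall B, measurable B -> mu2 R (phi @^-1` B) = mu2 R B) ->
    measurable K -> measurable_fun setT f ->
    (mu2 R).-integrable (phi @^-1` K) (EFin \o (f \o phi)) ->
  \int[mu2 R]_(z in K) f z = \int[mu2 R]_(z in phi @^-1` K) f (phi z).
Proof.
move=> mphi pres mK mf intf; congr fine.
transitivity (\int[pushforward (mu2 R) phi]_(z in K) (f z)%:E)%E.
  by apply: eq_measure_integral => B mB _; exact/esym/pres.
by rewrite integral_pushforward //; exact/measurable_EFinP.
Qed.

Lemma Rintegral_odd K f : measurable K -> (mu2 R K < +oo)%E -> tame K f ->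
    (forall z, K z -> K (- z)) -> (forall z, f (- z) = - f z) ->
  \int[mu2 R]_(z in K) f z = 0.
Proof.
move=> mK Kfin tf Ksym fodd.
have KE : -%R @^-1` K = K.
  by apply/seteqP; split=> z /= /Ksym; rewrite ?opprK.
have intf := tame_integrable mK Kfin tf.
have E : \int[mu2 R]_(z in K) f z = - \int[mu2 R]_(z in K) f z.
  rewrite {1}(@Rintegral_preserved (-%R : T * T -> T * T)) ?KE //.
  - rewrite -mulN1r -RintegralZl //; apply: eq_Rintegral => z _.
    by rewrite fodd mulN1r.
  - exact: measurable_opp_plane.
  - exact: mu2_opp.
  - by have [] := tf.
  - rewrite (_ : _ \o _ = fun z => (-1 * f z)%:E); last by apply/funext => z /=; rewrite fodd mulN1r.
    exact: (tame_integrable mK Kfin (tameM (tame_cst K (-1)) tf)).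
lra.
Qed.

(** If the integral were 0, f would vanish almost everywhere on K, so that B would
    be negligible. *)
Lemma Rintegral_gt0 K B f : measurable K -> (mu2 R K < +oo)%E -> tame K f ->
    (forall z, K z -> 0 <= f z) -> measurable B -> B `<=` K ->
    (forall z, B z -> 0 < f z) -> (0 < mu2 R B)%E ->
  0 < \int[mu2 R]_(z in K) f z.
Proof.
move=> mK Kfin tf f0 mB BK Bf B0; rewrite lt_neqAle Rintegral_ge0 // andbT.
apply: contraTneq B0 => int0; rewrite -leNgt.
have intf := tame_integrable mK Kfin tf.
have /ae_eq_integral_abs : (\int[mu2 R]_(z in K) `|(f z)%:E| = 0)%E.
  under eq_integral => z /set_mem Kz do rewrite gee0_abs ?lee_fin ?f0 //.
  have /fineK <- : (\int[mu2 R]_(z in K) (f z)%:E)%E \is a fin_num.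
    exact: integrable_fin_num.
  by rewrite -[fine _]/(\int[mu2 R]_(z in K) f z) -int0.
move=> /(_ mK (measurable_int _ intf)) ae0.
suff /negligibleP -> : (mu2 R).-negligible B by [].
apply: negligibleS ae0 => z Bz /= /(_ (BK _ Bz)) [fz].
by have := Bf _ Bz; rewrite fz ltxx.
Qed.

Lemma tame_fst K M : (forall z, K z -> `|z.1| <= M /\ `|z.2| <= M) -> tame K fst.
Proof. by move=> KM; split; [exact: measurable_fst|exists M => z /KM[]]. Qed.

Lemma tame_snd K M : (forall z, K z -> `|z.1| <= M /\ `|z.2| <= M) -> tame K snd.
Proof. by move=> KM; split; [exact: measurable_snd|exists M => z /KM[]]. Qed.

Definition moment K f g : R := \int[mu2 R]_(z in K) (f z * g z).

Lemma momentC K f g : moment K f g = moment K g f.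
Proof. by apply: eq_Rintegral => z _; rewrite mulrC. Qed.

Lemma momentDl K f g h (c : R) : measurable K -> (mu2 R K < +oo)%E ->
    tame K f -> tame K g -> tame K h ->
  moment K (fun z => f z + c * g z) h = moment K f h + c * moment K g h.
Proof.
move=> mK Kfin tf tg th.
have tI k : tame K k -> (mu2 R).-integrable K (EFin \o k) by exact: tame_integrable.
rewrite /moment -RintegralZl //; last exact/tI/tameM.
rewrite -RintegralD //.
- by apply: eq_Rintegral => z _; ring.
- exact/tI/tameM.
- by apply: tI; apply: (tameM (tame_cst _ _)); exact: tameM.
Qed.

(** Symmetry makes the first moments vanish, so the covariances are the second
    moments divided by the area. *)
Lemma calC_inv K : measurable K -> (mu2 R K < +oo)%E -> tame K fst -> tame K snd ->
    (forall z, K z -> K (- z)) ->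
  (calC K)^-1 = (moment K fst fst * moment K snd snd - moment K fst snd ^+ 2) / area K ^+ 4.
Proof.
move=> mK Kfin t1 t2 Ksym.
have m1 : mean K (coordinate 0) = 0.
  by rewrite /mean (Rintegral_odd mK Kfin t1) ?mul0r.
have m2 : mean K (coordinate 1) = 0.
  by rewrite /mean (Rintegral_odd mK Kfin t2) ?mul0r.
have det2 (A : 'M[R]_2) : \det A = A 0 0 * A 1 1 - A 0 1 * A 1 0.
  rewrite (expand_det_row _ 0) !big_ord_recl big_ord0 addr0 /cofactor !det_mx11 !mxE /=.
  have -> : lift 0 0 = 1 :> 'I_2 by exact/val_inj.
  have -> : lift 1 0 = 0 :> 'I_2 by exact/val_inj.
  by rewrite !expr0 !expr1 /bump /=; ring.
rewrite /calC invf_div det2 !mxE m1 m2 !mulr0 !subr0.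
rewrite /mean -![\int[_]_(_ in _) (coordinate _ _ * _)]/(moment K _ _).
rewrite -[coordinate 0]/fst -[coordinate 1]/snd (momentC K snd fst).
have [->|A0] := eqVneq (area K) 0; first by rewrite !expr0n !invr0 !mulr0.
by field.
Qed.

End Moments.

(** * Second moments under a shear *)

Section ShearFamily.
Variable R : realType.
Local Notation T := (measurableTypeR R).
Local Notation mu := (@lebesgue_measure R).
Implicit Types (B K : set (T * T)) (f g : T * T -> R).

(** The integral of (f + c g)^2 is positive for every c; c is chosen to minimize
    it. *)
Lemma cauchy_schwarz_strict K f g : measurable K -> (mu2 R K < +oo)%E ->
    tame K f -> tame K g -> 0 < moment K g g ->
    (forall c : R, exists B, [/\ measurable B, B `<=` K, (0 < mu2 R B)%E &
       forall z, B z -> f z + c * g z != 0]) ->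
  moment K f g ^+ 2 < moment K f f * moment K g g.
Proof.
move=> mK Kfin tf tg gg indep.
pose c := - moment K f g / moment K g g.
have [B [mB BK B0 fgB]] := indep c.
have tcg : tame K (fun z => c * g z) by exact: (tameM (tame_cst _ _)).
have tfg : tame K (fun z => f z + c * g z) by exact: tameD.
have : 0 < moment K (fun z => f z + c * g z) (fun z => f z + c * g z).
  apply: (Rintegral_gt0 mK Kfin (tameM tfg tfg) _ mB BK _ B0) => z Bz.
    by rewrite -expr2 sqr_ge0.
  by rewrite -expr2 lt_neqAle sqr_ge0 andbT eq_sym sqrf_eq0 fgB.
rewrite momentDl // (momentC K f) (momentC K g) !momentDl // (momentC K g f).
have -> : moment K f f + c * moment K f g + c * (moment K f g + c * moment K g g) =
    (moment K f f * moment K g g - moment K f g ^+ 2) / moment K g g.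
  by rewrite /c; field; exact: lt0r_neq0.
by rewrite pmulr_lgt0 ?invr_gt0 // subr_gt0.
Qed.

Lemma calC_shear K0 K (s : R -> R) (tau : R) :
    measurable K0 -> (mu2 R K0 < +oo)%E -> tame K0 fst -> tame K0 snd ->
    measurable_fun [set: T] s -> tame K0 (s \o snd) ->
    measurable K -> tame K fst -> tame K snd -> (forall z, K z -> K (- z)) ->
    K0 = shear (fun v => tau * s v) @^-1` K ->
  (calC K)^-1 =
    ((moment K0 fst fst + 2 * tau * moment K0 fst (s \o snd)
        + tau ^+ 2 * moment K0 (s \o snd) (s \o snd)) * moment K0 snd snd
      - (moment K0 fst snd + tau * moment K0 (s \o snd) snd) ^+ 2) / area K0 ^+ 4.
Proof.
move=> mK0 fin0 tx ty ms ts mK tKx tKy Ksym K0E.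
have mg : measurable_fun [set: T] (fun v => tau * s v).
  by apply: measurable_funM => //; exact: measurable_cst.
have pres := mu2_shear mg.
have muE : mu2 R K = mu2 R K0 by rewrite K0E -pres.
have tX : tame K0 (fun z => z.1 + tau * s z.2).
  by apply: (tameD tx); exact: (tameM (tame_cst _ _)).
have change f g : tame K f -> tame K g ->
    tame K0 (f \o shear (fun v => tau * s v)) ->
    tame K0 (g \o shear (fun v => tau * s v)) ->
    moment K f g = moment K0 (f \o shear (fun v => tau * s v)) (g \o shear (fun v => tau * s v)).
  move=> tf tg tf0 tg0; rewrite /moment (@Rintegral_preserved _ (shear (fun v => tau * s v))) //.
  - by rewrite -K0E.
  - exact: measurable_shear.
  - by have [] := tameM tf tg.
  - by rewrite -K0E; apply: tame_integrable => //; exact: tameM.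
rewrite calC_inv //; last by rewrite muE.
rewrite !change // /area muE.
rewrite (_ : fst \o shear _ = fun z => z.1 + tau * (s \o snd) z) //.
rewrite (_ : snd \o shear _ = snd) //.
rewrite !momentDl // !(momentC K0 _ (fun z => _ + _)) !momentDl //.
rewrite (momentC K0 (s \o snd) fst).
by congr (_ / _); ring.
Qed.

End ShearFamily.

(** A nonzero affine function has at most one root, which misses one of the two
    halves of the interval. *)
Lemma affine_nonvanishing (R : realFieldType) (al be c d : R) : be != 0 -> c < d ->
  exists c' d', [/\ c <= c', c' < d', d' <= d &
    forall v, c' < v < d' -> al * v + be != 0].
Proof.
move=> be0 cd; have [->|al0] := eqVneq al 0.
  by exists c, d; split=> // v _; rewrite mul0r add0r.
have root v : al * v + be == 0 -> v = - be / al.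
  by move/eqP => E; apply: (mulfI al0); rewrite [RHS]mulrC divfK //; lra.
have [le|lt] := leP (- be / al) ((c + d) / 2).
  exists ((c + d) / 2), d; split; [lra|lra|lra|].
  by move=> v /andP[v1 _]; apply: contraTN v1 => /root ->; rewrite -leNgt.
exists c, ((c + d) / 2); split; [lra|lra|lra|].
by move=> v /andP[_ v2]; apply: contraTN v2 => /root ->; rewrite -leNgt ltW.
Qed.

Lemma mu2_rectangle_gt0 (R : realType) (a b c d : R) : a < b -> c < d ->
  (0 < mu2 R (`]a, b[ `*` `]c, d[))%E.
Proof.
move=> ab cd; rewrite product_measure1E; [|exact: measurable_itv..].
rewrite /= !lebesgue_measure_itv /= !lte_fin ab cd.
by rewrite -!EFinB -EFinM lte_fin mulr_gt0 ?subr_gt0.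
Qed.

(** * The quadratic polynomial *)

Section QuadraticFamily.
Variables (R : realType) (m : nat) (x y : nat -> R).
Hypothesis hS : class_S m x y.
Local Notation T := (measurableTypeR R).

Lemma slide_compact t : compact (slide m x y t).
Proof.
rewrite /slide /sym_polygon; case: (sym_vertices _ _ _)
  (size_sym_vertices m [eta x with 2%N |-> t] y) => [|v l _].
  by have m3 := class_S_m hS; case: (m) m3.
exact: co_seq_compact.
Qed.

(** As x_3 <= x_2 <= x_1, the triangle over the top edge contains, up to half its
    height, everything that lies horizontally between the midpoints of its two
    slanted sides. *)
Lemma slide_rectangle :
  `](x 3%N + x 2%N) / 2, (x 1%N + x 2%N) / 2[ `*` `]y 1%N, (y 1%N + y 2%N) / 2[
  `<=` slide m x y (x 2%N).
Proof.
have /andP[x32 x21] := class_S_x hS.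
have y12 : y 1%N < y 2%N by rewrite (class_S_y13 hS) (class_S_y32 hS).
move=> [a b] /= [] /[!in_itv] /= /andP[a1 a2] /andP[b1 b2].
pose s := (b - y 1%N) / (y 2%N - y 1%N).
have s0 : 0 <= s by apply: divr_ge0; lra.
have s1 : s < 1 / 2 by rewrite ltr_pdivrMr; lra.
pose r := (a - s * x 2%N) / (1 - s).
have rc : core m x y (r, y 1%N).
  apply: (top_edge_core hS); rewrite /r ler_pdivlMr ?ler_pdivrMr; [|lra..].
  by apply/andP; split; nra.
have -> : (a, b) = mix s (x 2%N, y 2%N) (r, y 1%N).
  by rewrite /mix /r /s /=; congr (_, _); field; lra.
have s01 : 0 <= s <= 1 by apply/andP; split; lra.
exact: (co_cvx s01 (@slide_apex R m x y (x 2%N) (ltnW (class_S_m hS)))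
  (@core_sub_slide R m x y (x 2%N) _ rc)).
Qed.

Lemma measurable_profile (h H : R) : measurable_fun [set: T] (profile h H : T -> T).
Proof.
apply: (@measurable_funM _ T R); last exact: measurable_cst.
apply: (@measurable_funB _ T R); apply: (@measurable_maxr _ T R) => //.
  by apply: (@measurable_funB _ T R).
by apply: (@measurable_funB _ T R) => //; exact: (@measurable_funN _ T R).
Qed.

Lemma profile_le (h H v : R) : 0 <= h -> h < H -> `|profile h H v| <= `|v| / (H - h).
Proof.
move=> h0 hH; rewrite /profile normrM normfV [`|H - h|]gtr0_norm ?subr_gt0 //.
rewrite ler_pM2r ?invr_gt0 ?subr_gt0 //.
have [v0|v0] := leP 0 v.
  rewrite (ger0_norm v0) [Num.max (- v - h) 0]max_r ?subr0; last lra.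
  by rewrite ger0_norm ?le_max ?lexx ?orbT // ge_max v0 andbT; lra.
rewrite (ltr0_norm v0) [Num.max (v - h) 0]max_r ?sub0r; last lra.
rewrite normrN ger0_norm ?le_max ?lexx ?orbT // ge_max; apply/andP; split; lra.
Qed.

Lemma slide_quadratic (xi_l xi_r : R) :
    is_xi_l m x y xi_l -> is_xi_r m x y xi_r ->
  exists a b c : R, 0 < c /\ forall t, xi_l <= t <= xi_r ->
    (calC (slide m x y t))^-1 = a + b * t + c * t ^+ 2.
Proof.
move=> hl hr.
have h0 := top_height_gt0 hS.
have hH : y 1%N < y 2%N by rewrite (class_S_y13 hS) (class_S_y32 hS).
have /andP[x32 x21] := class_S_x hS.
have x31 := top_edge_lt hS.
have /andP[xil xir] := xi_bounds hS hl hr.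
pose s := profile (y 1%N) (y 2%N) : R -> R.
pose K := slide m x y (x 2%N) : set (T * T).
have mslide t : measurable (slide m x y t : set (T * T)).
  by apply: compact_measurable_plane; exact: slide_compact.
have tslide t : exists M : R, forall z, slide m x y t z -> `|z.1| <= M /\ `|z.2| <= M.
  by apply: compact_coordinates; exact: slide_compact.
have [M KM] := tslide (x 2%N).
have Kfin : (mu2 R K < +oo)%E := bounded_mu2_fin (mslide _) KM.
have tx : tame K fst := tame_fst KM.
have ty : tame K snd := tame_snd KM.
have ts : tame K (s \o snd).
  split; first by apply: measurableT_comp; [exact: measurable_profile|exact: measurable_snd].
  exists (M / (y 2%N - y 1%N)) => z Kz /=.
  apply: le_trans (profile_le _ (ltW h0) hH) _.
  by rewrite ler_pM2r ?invr_gt0 ?subr_gt0 //; have [] := KM _ Kz.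
pose X := `](x 3%N + x 2%N) / 2, (x 1%N + x 2%N) / 2[%classic : set T.
have box c' d' : y 1%N <= c' -> c' < d' -> d' <= (y 1%N + y 2%N) / 2 ->
    [/\ measurable (X `*` `]c', d'[ : set (T * T)), X `*` `]c', d'[ `<=` K &
        (0 < mu2 R (X `*` `]c', d'[))%E].
  move=> c1 cd d1; split; last by apply: mu2_rectangle_gt0 => //; lra.
    by apply: measurableX; exact: measurable_itv.
  move=> z [zX zY]; apply: slide_rectangle; split=> //.
  by move: zY; rewrite /= !in_itv /= => /andP[? ?]; apply/andP; split; lra.
have [mB BK B0] := box _ _ (lexx (y 1%N)) (ltac:(lra) : y 1%N < (y 1%N + y 2%N) / 2) (lexx _).
have yy : 0 < moment K snd snd.
  apply: (Rintegral_gt0 (mslide _) Kfin (tameM ty ty) _ mB BK _ B0) => z.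
    by rewrite -expr2 sqr_ge0.
  by case=> _ /=; rewrite in_itv /= => /andP[z1 _]; apply: mulr_gt0; lra.
have cs : moment K (s \o snd) snd ^+ 2 < moment K (s \o snd) (s \o snd) * moment K snd snd.
  apply: (cauchy_schwarz_strict (mslide _) Kfin ts ty yy) => c.
  (* above the top edge the profile plus c v equals al v + be *)
  pose al := c + (y 2%N - y 1%N)^-1; pose be := - y 1%N / (y 2%N - y 1%N).
  have be0 : be != 0 by rewrite mulf_neq0 ?oppr_eq0 ?invr_eq0 ?lt0r_neq0 //; lra.
  have [c' [d' [c1 cd d1 nz]]] := affine_nonvanishing al be0
    (ltac:(lra) : y 1%N < (y 1%N + y 2%N) / 2).
  have [mB' BK' B0'] := box _ _ c1 cd d1.
  exists (X `*` `]c', d'[); split=> // z [_]; rewrite /= in_itv /= => zY.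
  rewrite /s profile_high ?(ltW h0) //; last by case/andP: zY; lra.
  rewrite (_ : _ + _ = al * z.2 + be) ?nz // /al /be; field; lra.
have A0 : 0 < area K.
  rewrite /area fine_gt0 // Kfin andbT; apply: (lt_le_trans B0).
  by apply: le_measure => //; rewrite inE //; exact: mslide.
pose q := area K ^+ 4.
have q0 : 0 < q by exact: exprn_gt0.
pose C2 := (moment K (s \o snd) (s \o snd) * moment K snd snd
  - moment K (s \o snd) snd ^+ 2) / q.
pose C1 := 2 * (moment K fst (s \o snd) * moment K snd snd
  - moment K fst snd * moment K (s \o snd) snd) / q.
pose C0 := (moment K fst fst * moment K snd snd - moment K fst snd ^+ 2) / q.
exists (C0 - C1 * x 2%N + C2 * x 2%N ^+ 2), (C1 - 2 * C2 * x 2%N), C2; split.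
  by rewrite divr_gt0 // subr_gt0.
move=> t ht.
have [N SN] := tslide t.
have KE : K = shear (fun v => (t - x 2%N) * s v) @^-1` slide m x y t.
  by apply: (slideE hS hl hr ht); rewrite !ltW.
rewrite (calC_shear (mslide _) Kfin tx ty (@measurable_profile _ _) ts (mslide t)
  (tame_fst SN) (tame_snd SN) (@slide_opp _ _ _ _ _) KE).
have qN : q != 0 by exact: lt0r_neq0.
rewrite /C2 /C1 /C0 -/q; move: q qN {q0 C0 C1 C2 cs} => q qN.
move: (moment _ _ _) (moment _ _ _) (moment _ _ _) (moment _ _ _) (moment _ _ _)
  (moment _ _ _) => a1 a2 a3 a4 a5 a6.
by field.
Qed.

End QuadraticFamily.

(** The gap in the convexity inequality is c k (1 - k) (u - v)^2. *)
Lemma quadratic_convex (R : realType) (l r a b c : R) (F : R -> R) : 0 <= c ->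
    (forall t, l <= t <= r -> F t = a + b * t + c * t ^+ 2) ->
  convex_function (`[l, r]%classic : set R) (F : R -> R^o).
Proof.
move=> c0 quad k u v; rewrite !inE /= !in_itv /= => hu hv.
have k0 : 0 <= k%:num by [].
have k1 : k%:num <= 1 by [].
have convE (f g : R) : conv k (f : R^o) g = k%:num * f + (1 - k%:num) * g by [].
have hk : l <= k%:num * u + (1 - k%:num) * v <= r.
  by case/andP: hu => ? ?; case/andP: hv => ? ?; apply/andP; split; nra.
rewrite convE -[conv k _ _]/(k%:num * u + (1 - k%:num) * v) (quad _ hu) (quad _ hv) (quad _ hk).
rewrite -subr_ge0 (_ : _ - _ = c * (k%:num * (1 - k%:num)) * (u - v) ^+ 2); last by ring.
have kk : 0 <= k%:num * (1 - k%:num) by rewrite mulr_ge0 ?subr_ge0.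
by apply: mulr_ge0; [exact: mulr_ge0|exact: sqr_ge0].
Qed.

Theorem lemma6p4 (R : realType) (m : nat) (x y : nat -> R) (xi_l xi_r : R)
    (hS : class_S m x y)
    (hl : is_xi_l m x y xi_l) (hr : is_xi_r m x y xi_r) :
  (exists p : {poly R}, size p = 3%N /\
     forall t : R, xi_l <= t <= xi_r -> (calC (slide m x y t))^-1 = p.[t]) /\
  convex_function (`[xi_l, xi_r]%classic : set R)
    (fun t : R => (calC (slide m x y t))^-1).
Proof.
have [a [b [c [c0 quad]]]] := slide_quadratic hS hl hr; split.
  exists (Poly [:: a; b; c]); split; first by rewrite (PolyK (c := 0)) //= lt0r_neq0.
  by move=> t /quad ->; rewrite horner_Poly /=; ring.
exact: (quadratic_convex (ltW c0) quad).
Qed.
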